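(* For all integers $c>0$, $d>0$, $n\ge 0$, all $m\in\mathbb{N}$ and all $\lambda,\mu,\nu\in\mathbb{C}$, the following symmetry identity, in the variables $x,y,X,Y$, holds for the Gould-Hopper Apostol type polynomials ${}_{H^{(s)}}\mathcal{F}_n^{(m)}(x,y;\lambda;\mu,\nu)$: $$\sum_{k=0}^{n}\binom{n}{k}c^{n-k}d^{\nu+k}\,{}_{H^{(s)}}\mathcal{F}_{n-k}^{(m)}(dx,d^{s}y;\lambda;\mu,\nu)\sum_{l=0}^{k}\binom{k}{l}\mathcal{S}_{l}(c-1,-\lambda)\,{}_{H^{(s)}}\mathcal{F}_{k-l}^{(m-1)}(cX,c^{s}Y;\lambda;\mu,\nu)$$ $$=\sum_{k=0}^{n}\binom{n}{k}d^{n-k}c^{\nu+k}\,{}_{H^{(s)}}\mathcal{F}_{n-k}^{(m)}(cx,c^{s}y;\lambda;\mu,\nu)\sum_{l=0}^{k}\binom{k}{l}\mathcal{S}_{l}(d-1,-\lambda)\,{}_{H^{(s)}}\mathcal{F}_{k-l}^{(m-1)}(dX,d^{s}Y;\lambda;\mu,\nu).$$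
   Context: Here $\mathbb{N}=\{1,2,\dots\}$ and $s$ is the (positive integer) index of the Gould-Hopper polynomials $H_n^{(s)}(x,y)$, whose generating function is $e^{xt+yt^s}$. The Gould-Hopper Apostol type polynomials ${}_{H^{(s)}}\mathcal{F}_n^{(m)}(x,y;\lambda;\mu,\nu)$ of order $m$ (with $m=0$ also allowed) are defined by the generating function $$\Big(\frac{2^\mu t^\nu}{\lambda e^{t}+1}\Big)^m e^{xt+yt^s}=\sum_{n=0}^{\infty}{}_{H^{(s)}}\mathcal{F}_n^{(m)}(x,y;\lambda;\mu,\nu)\frac{t^{n}}{n!}.$$ For an arbitrary real or complex number $a$, the generalized sums of integer powers $\mathcal{S}_k(n,a)$ are defined by $$\sum_{k=0}^{\infty}\mathcal{S}_{k}(n,a)\frac{t^k}{k!}=\frac{a e^{(n+1)t}-1}{a e^{t}-1}.$$ *)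

(* Defs.v *)
From Stdlib Require Import Reals Factorial.
From Coquelicot Require Import Coquelicot.

Open Scope C_scope.

Definition NtoC (n : nat) : C := RtoC (INR n).

(* [Binomial.C] is real-valued; the name [C] alone denotes the complex numbers. *)
Definition binom (n k : nat) : C := RtoC (Binomial.C n k).

Definition Cexp (z : C) : C :=
  ((exp (Re z) * cos (Im z))%R, (exp (Re z) * sin (Im z))%R).

(* Principal argument, in (-PI, PI], of a nonzero complex number. *)
Definition Carg (z : C) : R :=
  if Rle_dec 0 (Im z) then acos (Re z / Cmod z) else (- acos (Re z / Cmod z))%R.

Definition Clog (z : C) : C := (ln (Cmod z), Carg z).

(* Principal value of z ^ w; meaningful for z <> 0 only. Coquelicot's [Cpow],
   written [z ^ n], has exponents in nat. *)
Definition Cpower (z w : C) : C := Cexp (w * Clog z).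

(* g(t) = sum_n a_n t^n / n! on a punctured disc around 0. The point t = 0 is left
   out since a closed form such as t^nu / (1 - e^t) is not meaningful there. *)
Definition has_egf (a : nat -> C) (g : C -> C) : Prop :=
  exists r : R, (0 < r)%R /\
    forall t : C, (0 < Cmod t < r)%R ->
      is_series (fun n : nat => a n * (t ^ n / NtoC (fact n))) (g t).

Definition GHApostol_gf (s m : nat) (lambda mu nu x y t : C) : C :=
  (Cpower (RtoC 2) mu * Cpower t nu / (lambda * Cexp t + 1)) ^ m
  * Cexp (x * t + y * t ^ s).

(* [F n x y] is the n-th Gould-Hopper Apostol type polynomial of order m. Such an
   expansion does not exist for all nu: t^(m nu) must cancel the possible pole of
   1 / (lambda e^t + 1)^m at 0 and leave an integral power of t. *)
Definition is_GHApostol (s m : nat) (lambda mu nu : C) (F : nat -> C -> C -> C) : Prop :=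
  forall x y : C,
    has_egf (fun n => F n x y) (GHApostol_gf s m lambda mu nu x y).

(* [S k n a] is the generalized sum of integer powers S_k(n, a). *)
Definition is_gen_power_sum (S : nat -> nat -> C -> C) : Prop :=
  forall (n : nat) (a : C),
    has_egf (fun k => S k n a)
      (fun t => (a * Cexp (NtoC (n + 1) * t) - 1) / (a * Cexp t - 1)).

(* Main.v *)
(* Both sides are the n-th coefficients of the exponential generating function
     (c^nu d^nu 2^mu t^nu / ((lambda e^(ct) + 1) (lambda e^(dt) + 1)))^m (2^mu t^nu)^(m-1)
       (lambda e^(cdt) + 1) e^(cd (x + X) t + (cdt)^s (y + Y)),
   which is symmetric in c and d: the power sums S_l(c-1, -lambda) contribute the quotient
   (lambda e^(cdt) + 1) / (lambda e^(dt) + 1), which supplies the m-th factor of the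
   denominator in d. Principal powers satisfy (ct)^nu = c^nu t^nu because c > 0.
   Coefficients are determined by the values on a punctured disc. *)
Require Import Defs.
From Stdlib Require Import Reals Factorial Lra Lia.
From Coquelicot Require Import Coquelicot.

Open Scope C_scope.

(* [ring] and [field] reject equations typed in a Coquelicot structure over [C]. *)
Ltac Ceq := lazymatch goal with |- @eq _ ?a ?b => change (@eq C a b) end.
Ltac Cring := Ceq; ring.
Ltac Cfield := Ceq; field.

(** * Convergence and products of complex series *)

Lemma sum_n_Cmult_l (z : C) (a : nat -> C) (n : nat) :
  z * sum_n a n = sum_n (fun k => z * a k) n.
Proof. symmetry; apply (sum_n_mult_l (K := C_Ring)). Qed.

Lemma sum_n_Cmult_r (z : C) (a : nat -> C) (n : nat) :
  sum_n a n * z = sum_n (fun k => a k * z) n.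
Proof. symmetry; apply (sum_n_mult_r (K := C_Ring)). Qed.

Lemma sum_n_Re (a : nat -> C) (n : nat) : Re (sum_n a n) = sum_n (fun k => Re (a k)) n.
Proof.
induction n as [|n IH]; [now rewrite !sum_O|].
rewrite !sum_Sn, <- IH; reflexivity.
Qed.

Lemma sum_n_Im (a : nat -> C) (n : nat) : Im (sum_n a n) = sum_n (fun k => Im (a k)) n.
Proof.
induction n as [|n IH]; [now rewrite !sum_O|].
rewrite !sum_Sn, <- IH; reflexivity.
Qed.

(** The uniform structure on [C] is the product one, so balls split into real balls componentwise.
    This carries theorems on real series over to complex ones. *)
Lemma is_series_C (a : nat -> C) (l : C) :
  is_series a l <->
  is_series (fun n => Re (a n)) (Re l) /\ is_series (fun n => Im (a n)) (Im l).
Proof.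
unfold is_series; split.
- intros H.
  split; apply filterlim_locally; intros eps;
    generalize (proj1 (filterlim_locally (U := C_UniformSpace) _ _) H eps);
    apply filter_imp; intros n [H1 H2].
  + rewrite <- sum_n_Re; exact H1.
  + rewrite <- sum_n_Im; exact H2.
- intros [H1 H2].
  apply (filterlim_locally (U := C_UniformSpace)); intros eps.
  generalize (filter_and _ _
    (proj1 (filterlim_locally (U := R_UniformSpace) _ _) H1 eps)
    (proj1 (filterlim_locally (U := R_UniformSpace) _ _) H2 eps)); apply filter_imp; intros n [E1 E2].
  rewrite <- sum_n_Re in E1; rewrite <- sum_n_Im in E2; split; assumption.
Qed.

(* Mertens' theorem for real series, applied to real and imaginary parts. *)
Lemma is_series_Cmult (a b : nat -> C) (la lb : C) :
  is_series a la -> is_series b lb ->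
  ex_series (fun n => Cmod (a n)) -> ex_series (fun n => Cmod (b n)) ->
  is_series (fun n => sum_n (fun k => a k * b (n - k)%nat) n) (la * lb).
Proof.
assert (HRe : forall u : nat -> C, ex_series (fun n => Cmod (u n)) ->
  ex_series (fun n => Rabs (Re (u n)))).
{ intros u; apply (ex_series_le (V := R_CompleteNormedModule)); intros n.
  change (Rabs (Rabs (Re (u n))) <= Cmod (u n))%R.
  rewrite Rabs_Rabsolu; apply re_le_Cmod. }
assert (HIm : forall u : nat -> C, ex_series (fun n => Cmod (u n)) ->
  ex_series (fun n => Rabs (Im (u n)))).
{ intros u; apply (ex_series_le (V := R_CompleteNormedModule)); intros n.
  change (Rabs (Rabs (Im (u n))) <= Cmod (u n))%R.
  rewrite Rabs_Rabsolu; eapply Rle_trans; [apply Rmax_r | apply Rmax_Cmod]. }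
intros Ha Hb Aa Ab.
apply is_series_C in Ha as [Har Hai]; apply is_series_C in Hb as [Hbr Hbi].
assert (Hrr := is_series_mult _ _ _ _ Har Hbr (HRe _ Aa) (HRe _ Ab)).
assert (Hri := is_series_mult _ _ _ _ Har Hbi (HRe _ Aa) (HIm _ Ab)).
assert (Hir := is_series_mult _ _ _ _ Hai Hbr (HIm _ Aa) (HRe _ Ab)).
assert (Hii := is_series_mult _ _ _ _ Hai Hbi (HIm _ Aa) (HIm _ Ab)).
apply is_series_C; split.
- apply (is_series_ext (V := R_NormedModule)) with (2 := is_series_minus _ _ _ _ Hrr Hii).
  intros n; rewrite sum_n_Re, sum_n_Reals.
  symmetry; apply (minus_sum (fun k => (Re (a k) * Re (b (n - k)%nat))%R)).
- apply (is_series_ext (V := R_NormedModule)) with (2 := is_series_plus _ _ _ _ Hri Hir).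
  intros n; rewrite sum_n_Im, sum_n_Reals.
  symmetry; apply (sum_plus (fun k => (Re (a k) * Im (b (n - k)%nat))%R)).
Qed.

(** Convergent partial sums are bounded by some [M], and a term is a difference of two consecutive
    partial sums, hence bounded by [M + M]. *)
Lemma is_series_bounded_terms (a : nat -> C) (l : C) :
  is_series a l -> exists M : R, forall n, (Cmod (a n) <= M)%R.
Proof.
intros H; destruct (filterlim_bounded _ (ex_intro _ l H)) as [M HM].
exists (M + M)%R; intros n.
assert (HM0 : (0 <= M)%R) by (eapply Rle_trans; [apply Cmod_ge_0 | apply (HM O)]).
destruct n as [|n].
- generalize (HM O); rewrite sum_O; change (norm (a O)) with (Cmod (a O)); lra.
- replace (a (S n)) with (sum_n a (S n) + - sum_n a n).
  + eapply Rle_trans; [apply Cmod_triangle|]; rewrite Cmod_opp.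
    apply Rplus_le_compat; apply HM.
  + rewrite sum_Sn; change plus with Cplus; ring.
Qed.

(** Abel's lemma: the terms at [t] are bounded, so those at [z] are dominated by a geometric series
    of ratio [Cmod z / Cmod t]. It supplies the absolute convergence that Mertens' theorem asks
    for. *)
Lemma ex_series_Cmod_pow_lt (a : nat -> C) (t z l : C) :
  is_series (fun n => a n * t ^ n) l -> (Cmod z < Cmod t)%R ->
  ex_series (fun n => Cmod (a n * z ^ n)).
Proof.
intros H Hzt; destruct (is_series_bounded_terms _ _ H) as [M HM].
assert (Hz := Cmod_ge_0 z).
apply (ex_series_le (V := R_CompleteNormedModule))
  with (fun n => M * (Cmod z / Cmod t) ^ n)%R.
- intros n; change (Rabs (Cmod (a n * z ^ n)) <= M * (Cmod z / Cmod t) ^ n)%R.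
  rewrite Rabs_pos_eq by apply Cmod_ge_0.
  replace (Cmod (a n * z ^ n)) with (Cmod (a n * t ^ n) * (Cmod z / Cmod t) ^ n)%R.
  + apply Rmult_le_compat_r; [|apply HM].
    apply pow_le, Rmult_le_pos; [exact Hz | left; apply Rinv_0_lt_compat; lra].
  + rewrite !Cmod_mult, !Cmod_pow, Rmult_assoc, <- Rpow_mult_distr.
    do 3 f_equal; field; lra.
- apply (ex_series_scal (V := R_NormedModule) M), ex_series_geom.
  rewrite Rabs_pos_eq.
  + apply Rmult_lt_reg_r with (Cmod t); [lra|]; field_simplify; lra.
  + apply Rmult_le_pos; [exact Hz | left; apply Rinv_0_lt_compat; lra].
Qed.

(** * Operations on exponential generating functions *)

Lemma NtoC_fact_neq_0 (n : nat) : NtoC (fact n) <> 0.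
Proof. intros H; apply RtoC_inj in H; exact (INR_fact_neq_0 n H). Qed.

Lemma binom_fact (n k : nat) :
  binom n k = NtoC (fact n) / (NtoC (fact k) * NtoC (fact (n - k))).
Proof.
unfold binom, Binomial.C, NtoC.
rewrite RtoC_div, RtoC_mult; [reflexivity|].
apply Rmult_integral_contrapositive; split; apply INR_fact_neq_0.
Qed.

Lemma has_egf_ext (a b : nat -> C) (f g : C -> C) :
  (forall n, a n = b n) -> (forall t : C, t <> 0 -> f t = g t) ->
  has_egf a f -> has_egf b g.
Proof.
intros Hab Hfg [r [Hr H]]; exists r; split; [exact Hr|]; intros t Ht.
rewrite <- (Hfg t) by (apply Cmod_gt_0; lra).
apply is_series_ext with (2 := H t Ht); intros n; now rewrite Hab.
Qed.

Lemma has_egf_scal (k : C) (a : nat -> C) (f : C -> C) :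
  has_egf a f -> has_egf (fun n => k * a n) (fun t => k * f t).
Proof.
intros [r [Hr H]]; exists r; split; [exact Hr|]; intros t Ht.
apply is_series_ext with (2 := is_series_scal k _ _ (H t Ht)); intros n.
change scal with Cmult; Cring.
Qed.

(** The map sending [t] to [k * t] takes the punctured disc of radius [r / Cmod k] into that of
    radius [r]; [k <> 0] keeps the image away from 0. *)
Lemma has_egf_dilate (k : C) (a : nat -> C) (f : C -> C) :
  k <> 0 -> has_egf a f -> has_egf (fun n => k ^ n * a n) (fun t => f (k * t)).
Proof.
intros Hk [r [Hr H]]; apply Cmod_gt_0 in Hk.
exists (r / Cmod k)%R; split; [now apply Rdiv_lt_0_compat|]; intros t [Ht1 Ht2].
apply is_series_ext with (fun n => a n * ((k * t) ^ n / NtoC (fact n))).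
- intros n; rewrite Cpow_mult_l; unfold Cdiv; Cring.
- apply H; rewrite Cmod_mult; split; [now apply Rmult_lt_0_compat|].
  apply Rmult_lt_compat_l with (1 := Hk) in Ht2.
  replace r with (Cmod k * (r / Cmod k))%R by (field; lra); exact Ht2.
Qed.

(** Cauchy product: the factorials dividing the coefficients turn the convolution into a binomial
    one. *)
Lemma has_egf_mult (a b : nat -> C) (f g : C -> C) :
  has_egf a f -> has_egf b g ->
  has_egf (fun n => sum_n (fun k => binom n k * a k * b (n - k)%nat) n)
    (fun t => f t * g t).
Proof.
intros [r [Hr Hf]] [q [Hq Hg]].
set (p := Rmin r q); assert (Hp : (0 < p)%R) by (now apply Rmin_glb_lt).
assert (Hpr := Rmin_l r q : (p <= r)%R); assert (Hpq := Rmin_r r q : (p <= q)%R).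
exists p; split; [exact Hp|]; intros t Ht.
(* A point with [Cmod t < Cmod u < p]: plain convergence of both series at [u] gives absolute
   convergence at [t]. *)
set (u := RtoC ((Cmod t + p) / 2)).
assert (Hu : Cmod u = ((Cmod t + p) / 2)%R).
{ unfold u; rewrite Cmod_R; apply Rabs_pos_eq; lra. }
assert (Habs : forall (e : nat -> C) (h : C -> C),
  is_series (fun n => e n * (u ^ n / NtoC (fact n))) (h u) ->
  ex_series (fun n => Cmod (e n * (t ^ n / NtoC (fact n))))).
{ intros e h He.
  apply ex_series_ext with (fun n => Cmod (e n / NtoC (fact n) * t ^ n)).
  - intros n; f_equal; unfold Cdiv; Cring.
  - apply ex_series_Cmod_pow_lt with (t := u) (l := h u); [|rewrite Hu; lra].
    apply is_series_ext with (2 := He); intros n; unfold Cdiv; Cring. }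
assert (Hc := is_series_Cmult _ _ _ _ (Hf t ltac:(lra)) (Hg t ltac:(lra))
  (Habs a f (Hf u ltac:(lra))) (Habs b g (Hg u ltac:(lra)))).
apply is_series_ext with (2 := Hc); intros n.
rewrite sum_n_Cmult_r; apply sum_n_ext_loc; intros k Hk.
rewrite binom_fact.
replace (t ^ n) with (t ^ k * t ^ (n - k)) by (rewrite <- Cpow_add_r; f_equal; lia).
Cfield; repeat split; apply NtoC_fact_neq_0.
Qed.

(** * Uniqueness of the coefficients *)

Lemma PSeries_coef_unique (a b : nat -> R) (f : R -> R) (r : R) :
  (0 < r)%R ->
  (forall x : R, (0 < Rabs x < r)%R ->
     is_series (fun n => a n * x ^ n)%R (f x) /\ is_series (fun n => b n * x ^ n)%R (f x)) ->
  forall n, a n = b n.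
Proof.
intros Hr H n.
assert (Hcv : forall e : nat -> R,
  (forall x : R, (0 < Rabs x < r)%R -> is_series (fun n => e n * x ^ n)%R (f x)) ->
  Rbar_lt 0 (CV_radius e)).
(* With radius 0, the point [r / 2] would lie outside the disc of convergence, where the terms
   cannot tend to 0. *)
{ intros e He; apply Rbar_not_le_lt; intros Hle.
  assert (Hx : (Rabs (r / 2) = r / 2)%R) by (apply Rabs_pos_eq; lra).
  apply (CV_disk_outside e (r / 2)).
  - apply Rbar_le_lt_trans with (1 := Hle); simpl; rewrite Hx; lra.
  - apply ex_series_lim_0; exists (f (r / 2)%R); apply He; lra. }
assert (Ha := Hcv a (fun x Hx => proj1 (H x Hx))).
assert (Hb := Hcv b (fun x Hx => proj2 (H x Hx))).
assert (Heq : forall x : R, (0 < Rabs x < r)%R -> PSeries a x = PSeries b x).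
{ intros x Hx; unfold PSeries; destruct (H x Hx) as [H1 H2].
  now rewrite (is_series_unique _ _ H1), (is_series_unique _ _ H2). }
(* The hypothesis is silent at 0, so the values there are compared as limits of the two continuous
   sums, which agree on the punctured interval. *)
assert (H0 : PSeries a 0 = PSeries b 0).
{ assert (Hlim : forall e, Rbar_lt 0 (CV_radius e) -> is_lim (PSeries e) 0 (PSeries e 0)).
  { intros e He; apply is_lim_continuity, PSeries_continuity; now rewrite Rabs_R0. }
  assert (L1 := is_lim_unique _ _ _ (Hlim b Hb)).
  assert (L2 := Hlim a Ha).
  apply (is_lim_ext_loc _ (PSeries b)) in L2.
  - apply is_lim_unique in L2; congruence.
  - exists (mkposreal r Hr); intros y Hy Hy0.
    change (Rabs (y - 0) < r)%R in Hy; rewrite Rminus_0_r in Hy.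
    apply Heq; split; [now apply Rabs_pos_lt | exact Hy]. }
apply PSeries_ext_recip; [exact Ha | exact Hb |].
exists (mkposreal r Hr); intros y Hy.
change (Rabs (y - 0) < r)%R in Hy; rewrite Rminus_0_r in Hy.
destruct (Req_dec y 0) as [->|Hy0]; [exact H0|].
apply Heq; split; [now apply Rabs_pos_lt | exact Hy].
Qed.

(** Real arguments suffice: there [t ^ n / n!] is real, so real and imaginary parts of the
    coefficients give separate real power series. *)
Lemma has_egf_unique (a b : nat -> C) (f : C -> C) :
  has_egf a f -> has_egf b f -> forall n, a n = b n.
Proof.
intros [r [Hr Ha]] [q [Hq Hb]] n.
(* [P] stands for [Re] or [Im]; compatibility with real factors is all that is used of it. *)
assert (Hreal : forall (e : nat -> C) (x l : R) (P : C -> R),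
  (forall (z : C) (u : R), P (z * RtoC u) = (P z * u)%R) ->
  is_series (fun n => P (e n * (RtoC x ^ n / NtoC (fact n)))) l ->
  is_series (fun n => P (e n) / INR (fact n) * x ^ n)%R l).
{ intros e x l P HP; apply is_series_ext; intros k.
  unfold NtoC; rewrite <- RtoC_pow, <- RtoC_div by apply INR_fact_neq_0.
  rewrite HP; unfold Rdiv; match goal with |- @eq _ ?u ?v => change (@eq R u v) end; ring. }
assert (HRe : forall (z : C) (u : R), Re (z * RtoC u) = (Re z * u)%R)
  by (intros [z1 z2] u; simpl; ring).
assert (HIm : forall (z : C) (u : R), Im (z * RtoC u) = (Im z * u)%R)
  by (intros [z1 z2] u; simpl; ring).
assert (Hpos : (0 < Rmin r q)%R) by (now apply Rmin_glb_lt).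
assert (Hl := Rmin_l r q); assert (Hr' := Rmin_r r q).
assert (Hdiv : forall u v : R, (u / INR (fact n) = v / INR (fact n))%R -> u = v).
{ intros u v E; apply (Rmult_eq_reg_r (/ INR (fact n))); [exact E|].
  apply Rinv_neq_0_compat, INR_fact_neq_0. }
apply injective_projections; apply Hdiv.
- apply (PSeries_coef_unique (fun n => Re (a n) / INR (fact n))%R
    (fun n => Re (b n) / INR (fact n))%R (fun x => Re (f (RtoC x))) (Rmin r q) Hpos).
  intros x Hx; split; apply (Hreal _ x _ Re HRe).
  + apply (is_series_C _ (f x)), Ha; rewrite Cmod_R; lra.
  + apply (is_series_C _ (f x)), Hb; rewrite Cmod_R; lra.
- apply (PSeries_coef_unique (fun n => Im (a n) / INR (fact n))%R
    (fun n => Im (b n) / INR (fact n))%R (fun x => Im (f (RtoC x))) (Rmin r q) Hpos).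
  intros x Hx; split; apply (Hreal _ x _ Im HIm).
  + apply (is_series_C _ (f x)), Ha; rewrite Cmod_R; lra.
  + apply (is_series_C _ (f x)), Hb; rewrite Cmod_R; lra.
Qed.

(** * Exponential, argument and principal powers *)

Lemma Cexp_plus (z w : C) : Cexp (z + w) = Cexp z * Cexp w.
Proof.
destruct z as [z1 z2], w as [w1 w2]; unfold Cexp; apply injective_projections; simpl.
- rewrite exp_plus, cos_plus; ring.
- rewrite exp_plus, sin_plus; ring.
Qed.

Lemma Cexp_NtoC_mult (n : nat) (z : C) : Cexp (NtoC n * z) = Cexp z ^ n.
Proof.
induction n as [|n IH].
- unfold NtoC; simpl INR; rewrite Cmult_0_l; unfold Cexp; simpl.
  rewrite exp_0, cos_0, sin_0, Rmult_1_l, Rmult_0_r; reflexivity.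
- replace (NtoC (S n) * z) with (z + NtoC n * z)
    by (unfold NtoC; rewrite S_INR, RtoC_plus; ring).
  now rewrite Cexp_plus, IH, Cpow_S.
Qed.

Lemma Carg_pos_mult (r : R) (z : C) : (0 < r)%R -> Carg (RtoC r * z) = Carg z.
Proof.
intros Hr; unfold Carg.
assert (HI : Im (RtoC r * z) = (r * Im z)%R) by (destruct z; simpl; ring).
assert (HR : Re (RtoC r * z) = (r * Re z)%R) by (destruct z; simpl; ring).
rewrite HI, HR, Cmod_mult, Cmod_R, (Rabs_pos_eq r) by lra.
replace (r * Re z / (r * Cmod z))%R with (Re z / Cmod z)%R.
- destruct (Rle_dec 0 (Im z)) as [H|H], (Rle_dec 0 (r * Im z)) as [H'|H'];
    try reflexivity; exfalso; nra.
(* Only [r] is cancelled, so the case [Cmod z = 0] is covered too. *)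
- unfold Rdiv; rewrite Rinv_mult.
  transitivity (r * / r * (Re z * / Cmod z))%R; [rewrite Rinv_r by lra|]; ring.
Qed.

Lemma Clog_pos (r : R) : (0 < r)%R -> Clog (RtoC r) = RtoC (ln r).
Proof.
intros Hr; unfold Clog, Carg; rewrite Cmod_R, Rabs_pos_eq by lra; simpl.
destruct (Rle_dec 0 0) as [_|H]; [|lra].
unfold Rdiv; rewrite Rinv_r, acos_1 by lra; reflexivity.
Qed.

(** The principal logarithm is not additive in general; a positive real factor leaves the argument
    unchanged, so no multiple of 2 pi i appears. *)
Lemma Clog_pos_mult (r : R) (z : C) :
  (0 < r)%R -> z <> 0 -> Clog (RtoC r * z) = Clog (RtoC r) + Clog z.
Proof.
intros Hr Hz; apply Cmod_gt_0 in Hz.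
rewrite (Clog_pos r Hr); unfold Clog.
rewrite Carg_pos_mult, Cmod_mult, Cmod_R, (Rabs_pos_eq r), ln_mult by lra.
apply injective_projections; simpl; ring.
Qed.

Lemma Cpower_pos_mult (r : R) (z w : C) :
  (0 < r)%R -> z <> 0 -> Cpower (RtoC r * z) w = Cpower (RtoC r) w * Cpower z w.
Proof.
intros Hr Hz; unfold Cpower; rewrite Clog_pos_mult by assumption.
rewrite <- Cexp_plus; f_equal; ring.
Qed.

Lemma Cpower_plus_NtoC (r : R) (w : C) (k : nat) :
  (0 < r)%R -> Cpower (RtoC r) (w + NtoC k) = Cpower (RtoC r) w * RtoC r ^ k.
Proof.
intros Hr; unfold Cpower; rewrite Cmult_plus_distr_r, Cexp_plus, Cexp_NtoC_mult.
do 2 f_equal; rewrite Clog_pos by exact Hr; unfold Cexp; simpl.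
rewrite exp_ln, cos_0, sin_0, Rmult_1_r, Rmult_0_r by exact Hr; reflexivity.
Qed.

(* At [z = 0] both sides are [0], the value of Coquelicot's [w / 0]. *)
Lemma Cdiv_opp (w z : C) : - w / - z = w / z.
Proof.
unfold Cdiv, Cinv; destruct w as [w1 w2], z as [z1 z2].
apply injective_projections; simpl; unfold Rdiv;
  replace (- z1 * (- z1 * 1) + - z2 * (- z2 * 1))%R with (z1 * (z1 * 1) + z2 * (z2 * 1))%R
    by ring; ring.
Qed.

(** * Generating functions of the two sides *)

(** The inner convolution is dilated by [d], giving [d ^ k], and the outer family by [c], giving
    [c ^ (n - k)]; the scalar [d ^ nu] completes the power [d ^ (nu + k)]. *)
Lemma symmetric_sum_has_egf (s c d m p : nat) (lambda mu nu : C)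
    (A B : nat -> C -> C -> C) (S : nat -> nat -> C -> C) (x y X Y : C) :
  (0 < c)%nat -> (0 < d)%nat ->
  is_GHApostol s m lambda mu nu A -> is_GHApostol s p lambda mu nu B ->
  is_gen_power_sum S ->
  has_egf
    (fun n => sum_n (fun k =>
          binom n k * NtoC c ^ (n - k) * Cpower (NtoC d) (nu + NtoC k)
          * A (n - k)%nat (NtoC d * x) (NtoC d ^ s * y)
          * sum_n (fun l =>
                binom k l * S l (c - 1)%nat (- lambda)
                * B (k - l)%nat (NtoC c * X) (NtoC c ^ s * Y)) k) n)
    (fun t => Cpower (NtoC d) nu *
       ((- lambda * Cexp (NtoC c * (NtoC d * t)) - 1)
          / (- lambda * Cexp (NtoC d * t) - 1)
        * GHApostol_gf s p lambda mu nu (NtoC c * X) (NtoC c ^ s * Y) (NtoC d * t)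
        * GHApostol_gf s m lambda mu nu (NtoC d * x) (NtoC d ^ s * y) (NtoC c * t))).
Proof.
intros Hc Hd HA HB HS.
assert (Hne : forall k, (0 < k)%nat -> NtoC k <> 0).
{ intros k Hk H; apply RtoC_inj in H; apply lt_0_INR in Hk; lra. }
assert (Inner := has_egf_mult _ _ _ _ (HS (c - 1)%nat (- lambda))
  (HB (NtoC c * X) (NtoC c ^ s * Y))).
apply (has_egf_dilate (NtoC d) _ _ (Hne d Hd)) in Inner.
assert (Outer := has_egf_dilate (NtoC c) _ _ (Hne c Hc)
  (HA (NtoC d * x) (NtoC d ^ s * y))).
refine (has_egf_ext _ _ _ _ _ _
  (has_egf_scal (Cpower (NtoC d) nu) _ _ (has_egf_mult _ _ _ _ Inner Outer))).
- intros n; rewrite sum_n_Cmult_l; apply sum_n_ext; intros k.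
  rewrite (Cpower_plus_NtoC (INR d)) by (now apply lt_0_INR).
  fold (NtoC d); Cring.
- intros t _; cbv beta.
  (* The power sums up to [c - 1] have exponent [(c - 1) + 1], which is [c] because [c] is
     positive. *)
  now replace (c - 1 + 1)%nat with c by lia.
Qed.

(** The quotient from the power sums raises the [p] factors [1 / (lambda e^(dt) + 1)] to [p + 1],
    matching those in [c], and the scalar [d ^ nu] does the same for the powers of [d]. Inverses are
    handled as atoms, so vanishing denominators need no separate case. *)
Lemma symmetric_gf (s c d p : nat) (lambda mu nu x y X Y t : C) :
  (0 < c)%nat -> (0 < d)%nat -> t <> 0 ->
  Cpower (NtoC d) nu *
    ((- lambda * Cexp (NtoC c * (NtoC d * t)) - 1)
       / (- lambda * Cexp (NtoC d * t) - 1)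
     * GHApostol_gf s p lambda mu nu (NtoC c * X) (NtoC c ^ s * Y) (NtoC d * t)
     * GHApostol_gf s (S p) lambda mu nu (NtoC d * x) (NtoC d ^ s * y) (NtoC c * t)) =
  (Cpower (NtoC c) nu * Cpower (NtoC d) nu * Cpower (RtoC 2) mu * Cpower t nu
     / (lambda * Cexp (NtoC c * t) + 1) / (lambda * Cexp (NtoC d * t) + 1)) ^ (S p)
  * (Cpower (RtoC 2) mu * Cpower t nu) ^ p
  * (lambda * Cexp (NtoC c * NtoC d * t) + 1)
  * Cexp (NtoC c * NtoC d * (x + X) * t + (NtoC c * NtoC d * t) ^ s * (y + Y)).
Proof.
intros Hc Hd Ht; unfold GHApostol_gf.
replace (- lambda * Cexp (NtoC c * (NtoC d * t)) - 1)
  with (- (lambda * Cexp (NtoC c * (NtoC d * t)) + 1)) by ring.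
replace (- lambda * Cexp (NtoC d * t) - 1) with (- (lambda * Cexp (NtoC d * t) + 1)) by ring.
rewrite Cdiv_opp, (Cpower_pos_mult (INR c) t), (Cpower_pos_mult (INR d) t)
  by (try apply lt_0_INR; assumption).
(* Variables scaled by [c] meet the argument [d * t] and conversely, so both exponents carry the
   same weights [c * d] and [(c * d) ^ s]. *)
replace (NtoC c * NtoC d * (x + X) * t + (NtoC c * NtoC d * t) ^ s * (y + Y))
  with ((NtoC c * X * (NtoC d * t) + NtoC c ^ s * Y * (NtoC d * t) ^ s)
        + (NtoC d * x * (NtoC c * t) + NtoC d ^ s * y * (NtoC c * t) ^ s))
  by (rewrite !Cpow_mult_l; ring).
rewrite !Cexp_plus, !Cmult_assoc; fold (NtoC c) (NtoC d).
unfold Cdiv; rewrite !Cpow_mult_l, !Cpow_S; ring.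
Qed.

Theorem corollary3p1 :
  forall (s c d n m : nat) (lambda mu nu : C)
         (F : nat -> nat -> C -> C -> C) (S : nat -> nat -> C -> C),
    (1 <= s)%nat -> (0 < c)%nat -> (0 < d)%nat -> (1 <= m)%nat ->
    is_GHApostol s m lambda mu nu (F m) ->
    is_GHApostol s (m - 1) lambda mu nu (F (m - 1)%nat) ->
    is_gen_power_sum S ->
    forall x y X Y : C,
      sum_n (fun k =>
          binom n k * NtoC c ^ (n - k) * Cpower (NtoC d) (nu + NtoC k)
          * F m (n - k)%nat (NtoC d * x) (NtoC d ^ s * y)
          * sum_n (fun l =>
                binom k l * S l (c - 1)%nat (- lambda)
                * F (m - 1)%nat (k - l)%nat (NtoC c * X) (NtoC c ^ s * Y)) k) n
      =
      sum_n (fun k =>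
          binom n k * NtoC d ^ (n - k) * Cpower (NtoC c) (nu + NtoC k)
          * F m (n - k)%nat (NtoC c * x) (NtoC c ^ s * y)
          * sum_n (fun l =>
                binom k l * S l (d - 1)%nat (- lambda)
                * F (m - 1)%nat (k - l)%nat (NtoC d * X) (NtoC d ^ s * Y)) k) n.
Proof.
intros s c d n m lambda mu nu F S _ Hc Hd Hm HA HB HS x y X Y; revert n.
assert (L := symmetric_sum_has_egf s c d m (m - 1) lambda mu nu _ _ S x y X Y
  Hc Hd HA HB HS).
assert (R := symmetric_sum_has_egf s d c m (m - 1) lambda mu nu _ _ S x y X Y
  Hd Hc HA HB HS).
(* [R] is [L] with [c] and [d] exchanged; the two closed forms only have to agree for [t <> 0]. *)
refine (has_egf_unique _ _ _ L (has_egf_ext _ _ _ _ (fun _ => eq_refl) _ R)).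
intros t Ht; destruct m as [|p]; [lia|].
replace (Datatypes.S p - 1)%nat with p by lia.
rewrite !symmetric_gf by assumption.
(* The exchange now shows only in the product [d * c] and in the order of factors in the base of the
   [(p + 1)]-st power. *)
rewrite (Cmult_comm (NtoC d) (NtoC c)).
unfold Cdiv; do 3 f_equal; f_equal; ring.
Qed.
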